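(* For every integer $t \ge 2$ there exists a real constant $c_t > 1$ such that for infinitely many integers $d \ge 2$ there exists a multigraph $G$ with $\max\{\Delta_t(G), a(G)\} = d$ and $a_t(G) \ge c_t d$.
   Context: A multigraph may have parallel edges but no loops. For a multigraph $G$ and a function $f : V(G) \to \mathbb{Z}_{\ge 2}$, a degree-$f$ forest of $G$ is a spanning subgraph that is a forest in which every vertex $v$ has degree at most $f(v)$. The degree-$f$ arboricity $a_f(G)$ is the minimum number of colors in an edge-coloring of $G$ in which every color class is a degree-$f$ forest; $a_t(G)$ denotes $a_f(G)$ for the constant function $f \equiv t$. The arboricity $a(G)$ is the minimum number of colors in an edge-coloring of $G$ in which each color class is a forest. $\Delta_f(G) = \max_{v \in V(G)} \lceil d(v)/f(v) \rceil$, where $d(v)$ is the degree of $v$ (counting parallel edges); $\Delta_t(G)$ denotes this for $f \equiv t$. *)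

(* Defs.v *)
From mathcomp Require Import all_boot.
From mathcomp Require Import boolp.

Set Implicit Arguments.
Unset Strict Implicit.
Unset Printing Implicit Defensive.

(* Edges form a type of their own, so distinct edges may have the same ends;
   an edge has exactly two ends, so there are no loops. *)
Record multigraph := Multigraph {
  vertex : finType;
  edge : finType;
  ends : edge -> {set vertex};
  card_ends : forall e, #|ends e| = 2 }.

Section Multigraph.
Variable G : multigraph.
Implicit Types (F : {set edge G}) (f : vertex G -> nat).

(* A spanning subgraph is identified with its edge set. *)
Definition degree F (v : vertex G) : nat := #|[set e in F | v \in ends e]|.

(* The cycle x_0 e_0 x_1 e_1 ... x_(k-1) e_(k-1) x_0 with k >= 2 distinct
   vertices xs and k distinct edges es; two parallel edges form a cycle with
   k = 2.  The relation all2 also forces xs and es to have the same size. *)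
Definition is_cycle F (xs : seq (vertex G)) (es : seq (edge G)) : bool :=
  [&& 1 < size xs, uniq xs, uniq es, all (mem F) es
    & all2 (fun e xy => ends e == [set xy.1; xy.2]) es (zip xs (rot 1 xs))].

Definition is_forest F : Prop := forall xs es, ~~ is_cycle F xs es.

Definition is_degree_forest f F : Prop :=
  is_forest F /\ forall v, degree F v <= f v.

(* A colouring with k colours need not use all of them. *)
Definition edge_colorable (P : {set edge G} -> Prop) (k : nat) : Prop :=
  exists c : edge G -> 'I_k, forall i, P [set e | c e == i].

Lemma is_forest_le1 F : #|F| <= 1 -> is_forest F.
Proof.
move=> F1 xs es; apply/negP => /and5P[xs1 _ ues /allP esF].
rewrite all2E => /andP[/eqP ses _].
have : size es <= #|F| by rewrite cardE uniq_leq_size // => e /esF; rewrite mem_enum.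
by rewrite ses size_zip size_rot minnn leqNgt (leq_ltn_trans F1 xs1).
Qed.

Lemma edge_colorable_le1 (P : {set edge G} -> Prop) :
  (forall F, #|F| <= 1 -> P F) -> edge_colorable P #|edge G|.
Proof.
move=> P1; exists enum_rank => i; apply: P1.
rewrite -(cards1 (enum_val i)); apply: subset_leq_card.
by apply/subsetP => e; rewrite !inE => /eqP <-; rewrite enum_rankK.
Qed.

Lemma arboricity_subproof : exists k, `[< edge_colorable is_forest k >].
Proof.
by exists #|edge G|; apply/asboolP/edge_colorable_le1; exact: is_forest_le1.
Qed.

Definition arboricity : nat := ex_minn arboricity_subproof.

Lemma degree_arboricity_subproof f (f2 : forall v, 2 <= f v) :
  exists k, `[< edge_colorable (is_degree_forest f) k >].
Proof.
exists #|edge G|; apply/asboolP/edge_colorable_le1 => F F1.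
split=> [|v]; first exact: is_forest_le1.
apply: leq_trans (ltnW (f2 v)); apply: leq_trans F1.
by apply: subset_leq_card; apply/subsetP => e; rewrite inE => /andP[].
Qed.

Definition degree_arboricity f (f2 : forall v, 2 <= f v) : nat :=
  ex_minn (degree_arboricity_subproof f2).

Definition ceil_div (m n : nat) : nat := m %/ n + ~~ (n %| m).

Definition max_degree_ratio f : nat :=
  \max_(v : vertex G) ceil_div (degree [set: edge G] v) (f v).

End Multigraph.

(* a_t(G) and Delta_t(G): the case of the constant function t. *)
Definition const_degree_arboricity (G : multigraph) t (t2 : 2 <= t) : nat :=
  @degree_arboricity G (fun=> t) (fun=> t2).

Definition const_max_degree_ratio (G : multigraph) t : nat :=
  @max_degree_ratio G (fun=> t).

(* Main.v *)
Require Import Defs.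
From mathcomp Require Import all_boot all_order all_algebra.
From mathcomp Require Import all_classical all_reals.
From mathcomp Require Import zify.

(* With d = 2m and t = T + 2, take three triangles u_i v_i w_i, where u_i v_i
   has multiplicity 2m and u_i w_i, v_i w_i have multiplicity m, link v_i to
   u_(i+1) (indices mod 3) by m parallel edges, and hang from each u_i and v_i
   T leaves by bundles of 2m parallel edges.  All u_i and v_i have degree t d,
   so in a decomposition into d degree-t forests each forest would span every
   triangle, contain one edge of each bundle, and saturate every u_i and v_i.
   Hence in each triangle exactly one of u_i and v_i is on a link edge of the
   forest, so the forests using a link are complementary to those using the
   next one; this is absurd around the odd cycle of links.  The weight
   [conn_weight] makes this quantitative: the total weight is m (24 T + 39),
   while a degree-t forest has weight at most 12 T + 19. *)

Set Implicit Arguments.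
Unset Strict Implicit.
Unset Printing Implicit Defensive.

Import Order.TTheory GRing.Theory Num.Theory.

(** * Cycles and forests in multigraphs *)

Section Forests.
Variable G : multigraph.
Implicit Types F : {set edge G}.

Lemma forest_parallel F e1 e2 :
  is_forest F -> e1 \in F -> e2 \in F -> ends e1 = ends e2 -> e1 = e2.
Proof.
move=> forF F1 F2 eq12; apply/eqP; apply/negP => /negP ne12.
have /cards2P[x [y [nxy exy]]] : #|ends e1| == 2 by rewrite card_ends.
apply: (negP (forF [:: x; y] [:: e1; e2])).
by rewrite /is_cycle /= !inE nxy ne12 F1 F2 -eq12 exy eqxx /= finset.setUC eqxx.
Qed.

Lemma forest_triangle F x y z e1 e2 e3 :
  is_forest F -> uniq [:: x; y; z] -> e1 \in F -> e2 \in F -> e3 \in F ->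
  ends e1 = [set x; y] -> ends e2 = [set y; z] -> ends e3 = [set z; x] -> False.
Proof.
move=> forF uxyz F1 F2 F3 E1 E2 E3.
have := uxyz; rewrite /= !inE negb_or andbT => /andP[/andP[nxy nxz] nyz].
apply: (negP (forF [:: x; y; z] [:: e1; e2; e3])).
have neq (e e' : edge G) v : (v \in ends e) != (v \in ends e') -> e != e'.
  by apply: contraNneq => ->.
rewrite /is_cycle uxyz /= !inE F1 F2 F3 E1 E2 E3 !eqxx !andbT negb_or.
rewrite (neq e1 e2 x) ?(neq e1 e3 y) ?(neq e2 e3 y) // ?E1 ?E2 ?E3 !inE eqxx ?orbT.
all: by rewrite ?(eq_sym y x) ?(negPf nxy) ?(negPf nxz) ?(negPf nyz).
Qed.

(* On a cycle, the vertex of largest rank would be the top of two edges. *)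
Lemma ranked_forest F (rank : vertex G -> nat) (low top : edge G -> vertex G) :
  {in F, forall e, ends e = [set low e; top e]} ->
  {in F, forall e, rank (low e) < rank (top e)} ->
  {in F &, injective top} -> is_forest F.
Proof.
move=> endsE rankP top_inj xs es; apply/negP => /and5P[n1 uxs ues /allP esF].
case: xs n1 uxs => [//|x0 xs'] n1 uxs; set xs := x0 :: xs' in n1 uxs *.
rewrite all2E size_zip size_rot minnn => /andP[/eqP ses].
have es0 : 0 < size es by rewrite ses.
have e0 : edge G by case: (es) es0.
move=> /(all_nthP (e0, (x0, x0))) zipP.
have nthE i : i < size xs ->
    ends (nth e0 es i) = [set nth x0 xs i; nth x0 xs (i.+1 %% size xs)].
  move=> ilt; have := zipP i; rewrite size_zip ses size_zip size_rot !minnn.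
  move=> /(_ ilt) /=; rewrite nth_zip ?ses ?size_zip ?size_rot ?minnn //.
  rewrite nth_zip ?size_rot //= => /eqP ->; congr [set _; _].
  rewrite rot1_cons nth_rcons; move: ilt; rewrite /= ltnS leq_eqVlt.
  case/orP => [/eqP ->|ilt]; first by rewrite ltnn eqxx modnn.
  by rewrite ilt modn_small.
have [i ilt imax] : exists2 i, i < size xs &
    forall j, j < size xs -> rank (nth x0 xs j) <= rank (nth x0 xs i).
  have i0 : 'I_(size xs) by exists 0.
  case: (@arg_maxnP _ i0 xpredT (fun i : 'I__ => rank (nth x0 xs i))) => // i _ H.
  by exists i => // j jlt; exact: (H (Ordinal jlt)).
have topE j : j < size xs -> nth x0 xs i \in ends (nth e0 es j) ->
    top (nth e0 es j) = nth x0 xs i.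
  move=> jlt iin; have jF : nth e0 es j \in F by apply: esF; rewrite mem_nth ?ses.
  have tin : top (nth e0 es j) \in ends (nth e0 es j).
    by rewrite endsE // !inE eqxx orbT.
  have le : rank (top (nth e0 es j)) <= rank (nth x0 xs i).
    move: tin; rewrite nthE // !inE => /orP[] /eqP ->; apply: imax => //.
    by rewrite ltn_mod.
  move: iin; rewrite endsE // !inE => /orP[] /eqP // il.
  by have := rankP _ jF; rewrite -il ltnNge le.
(* [j] is the cyclic predecessor of [i], so edges [j] and [i] of the cycle both contain the vertex
   of largest rank; they differ because the cycle has length at least 2. *)
pose j := if i is i'.+1 then i' else (size xs).-1.
have jlt : j < size xs by rewrite /j; case: (i) ilt => // i' /ltnW.
have ji : j.+1 %% size xs = i.
  rewrite /j; case: (i) ilt => [_|i' ilt]; last by rewrite modn_small.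
  by rewrite prednK ?modnn ?(ltnW n1).
have nij : i != j.
  rewrite /j; case: (i) => [|i']; last by rewrite eqn_leq ltnn.
  by rewrite eq_sym -lt0n ltn_predRL.
have: nth e0 es i = nth e0 es j.
  apply: top_inj; try by apply: esF; rewrite mem_nth ?ses.
  by rewrite !topE // nthE // !inE ?ji eqxx ?orbT.
by move/eqP; rewrite nth_uniq ?ses // (negPf nij).
Qed.

End Forests.

(** * Replacing each connection by a bundle of parallel edges *)

Section Fattening.
Variables (V C : finType) (h : C -> V * V) (mu : C -> nat).
Hypothesis loopless : forall c, (h c).1 != (h c).2.

Let ends_of (c : C) : {set V} := [set (h c).1; (h c).2].

Lemma card_ends_of (e : {c : C & 'I_(mu c)}) : #|ends_of (tag e)| = 2.
Proof. by rewrite cards2 loopless. Qed.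

Definition fattening : multigraph := Multigraph card_ends_of.

Implicit Types F : {set edge fattening}.

Definition mult F (c : C) : nat := #|[set e in F | tag e == c]|.

Lemma sum_tag F (w : C -> nat) :
  \sum_(e in F) w (tag e) = \sum_c mult F c * w c.
Proof.
rewrite (partition_big (fun e : edge fattening => tag e) xpredT) //=.
apply: eq_bigr => c _; rewrite -sum_nat_const; apply: congr_big => //.
  by move=> e; rewrite inE.
by move=> e /andP[_ /eqP ->].
Qed.

Lemma mult_setT : mult [set: edge fattening] = mu.
Proof.
apply/funext => c.
rewrite -[RHS]card_ord -cardsT /mult.
have inj : injective (fun j : 'I_(mu c) => Tagged (fun c => 'I_(mu c)) j).
  by move=> j k; apply: eq_from_Tagged.
rewrite -(card_imset _ inj); apply: eq_card => -[c' j]; rewrite !inE /=.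
apply/eqP/imsetP => [eqc | [k _ /(congr1 tag)] //]; subst c'; by exists j.
Qed.

Lemma degree_fattening F v :
  degree F v = \sum_c mult F c * (v \in ends_of c).
Proof.
rewrite -(sum_tag F (fun c => nat_of_bool (v \in ends_of c))) /degree.
by rewrite -sum1dep_card big_mkcondr; apply: eq_bigr => e _; case: ifP.
Qed.

Lemma mult_forest F c : is_forest F -> mult F c <= 1.
Proof.
move=> forF; rewrite leqNgt; apply/negP => /card_gt1P[e1 [e2 []]].
rewrite !inE => /andP[F1 /eqP t1] /andP[F2 /eqP t2] /eqP; apply.
by apply: (forest_parallel forF) => //; rewrite /= t1 t2.
Qed.

End Fattening.

(** The colour classes partition the edges and each weighs at most [W]. This turns a weight bound on
    forests into a lower bound on the number of colours. *)
Lemma colorable_weight (G : multigraph) (P : {set edge G} -> Prop) k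
    (w : edge G -> nat) W :
  (forall F, P F -> \sum_(e in F) w e <= W) ->
  edge_colorable P k -> \sum_e w e <= k * W.
Proof.
move=> wP [c cP]; rewrite (partition_big c xpredT) //=.
rewrite -[k in leqRHS]card_ord -sum_nat_const; apply: leq_sum => i _.
rewrite (leq_trans _ (wP _ (cP i))) // (eq_bigl [in [set e | c e == i]]) // => e.
by rewrite inE.
Qed.

(** * The necklace of three triangles *)

Section Necklace.
Variables T m : nat.

(* The beads u_i and v_i are (i, false) and (i, true). *)
Definition bead : finType := ('I_3 * bool)%type.

Definition i0 : 'I_3 := @Ordinal 3 0 isT.
Definition i1 : 'I_3 := @Ordinal 3 1 isT.
Definition i2 : 'I_3 := @Ordinal 3 2 isT.

(** Given by cases rather than modulo 3, so that it computes at [i0], [i1] and [i2]. *)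
Definition next_triangle (i : 'I_3) : 'I_3 :=
  match val i with 0 => i1 | 1 => i2 | _ => i0 end.
Definition prev_triangle (i : 'I_3) : 'I_3 :=
  match val i with 0 => i2 | 1 => i0 | _ => i1 end.

Lemma ord3P (P : 'I_3 -> Prop) : P i0 -> P i1 -> P i2 -> forall i, P i.
Proof.
move=> P0 P1 P2 [[|[|[|//]]] lt].
- by rewrite (_ : Ordinal lt = i0) //; apply: val_inj.
- by rewrite (_ : Ordinal lt = i1) //; apply: val_inj.
- by rewrite (_ : Ordinal lt = i2) //; apply: val_inj.
Qed.

Lemma sum_ord3 (f : 'I_3 -> nat) : \sum_i f i = f i0 + f i1 + f i2.
Proof.
rewrite !big_ord_recl big_ord0 addn0 addnA.
by congr (f _ + f _ + f _); apply: val_inj.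
Qed.

Definition node : finType := ((bead + 'I_3) + bead * 'I_T)%type.
Definition core (p : bead) : node := inl (inl p).
Definition hub (i : 'I_3) : node := inl (inr i).
Definition leaf (q : bead * 'I_T) : node := inr q.

Definition conn : finType := (('I_3 + bead) + ('I_3 + bead * 'I_T))%type.
Definition heavy (i : 'I_3) : conn := inl (inl i).
Definition spoke (p : bead) : conn := inl (inr p).
Definition link (i : 'I_3) : conn := inr (inl i).
Definition pendant (q : bead * 'I_T) : conn := inr (inr q).

(** The order of the ends matters for the forest decomposition: the first serves as [low] and the
    second as [top] in [ranked_forest]. *)
Definition conn_ends (c : conn) : node * node :=
  match c with
  | inl (inl i) => (core (i, false), core (i, true))
  | inl (inr p) => (core p, hub p.1)
  | inr (inl i) => (core (i, true), core (next_triangle i, false))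
  | inr (inr q) => (core q.1, leaf q)
  end.

Definition conn_mult (c : conn) : nat :=
  match c with
  | inl (inl _) | inr (inr _) => m.*2
  | _ => m
  end.

Lemma conn_loopless c : (conn_ends c).1 != (conn_ends c).2.
Proof. by case: c => [[i|[i s]]|[i|[[i s] j]]] //=; elim/ord3P: i. Qed.

Definition necklace : multigraph := fattening conn_mult conn_loopless.

(** Grouping by triangle leaves, after [sum_ord3], an explicit expression with six pendant sums,
    within reach of linear arithmetic although [T] is arbitrary. *)
Lemma sum_conn (f : conn -> nat) :
  \sum_c f c = \sum_i (f (heavy i) + f (spoke (i, false)) + f (spoke (i, true))
    + f (link i) + \sum_j f (pendant (i, false, j))
    + \sum_j f (pendant (i, true, j))).
Proof.
rewrite !big_sumType /= !big_split /= -!addnA; congr (_ + _).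
have sum_bead (g : bead -> nat) :
    \sum_p g p = \sum_i g (i, false) + \sum_i g (i, true).
  rewrite -big_split /=; transitivity (\sum_p g (p.1, p.2)).
    by apply: eq_bigr => -[].
  rewrite -(pair_bigA _ (fun i s => g (i, s))) /=.
  by apply: eq_bigr => i _; rewrite big_bool addnC.
rewrite sum_bead -!addnA; congr (_ + (_ + (_ + _))).
transitivity (\sum_q f (pendant (q.1, q.2))); first by apply: eq_bigr => -[].
rewrite -(pair_bigA _ (fun p j => f (pendant (p, j)))) /=.
by rewrite (sum_bead (fun p => \sum_j f (pendant (p, j)))).
Qed.

Lemma degree_core (F : {set edge necklace}) i s :
  degree F (core (i, s)) = mult F (heavy i) + mult F (spoke (i, s))
    + mult F (link (if s then i else prev_triangle i))
    + \sum_j mult F (pendant (i, s, j)).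
Proof.
rewrite degree_fattening sum_conn sum_ord3.
have pendE i' s' : \sum_j mult F (pendant (i', s', j)) *
    (core (i, s) \in [set (conn_ends (pendant (i', s', j))).1;
                         (conn_ends (pendant (i', s', j))).2]) =
    ((i, s) == (i', s')) * \sum_j mult F (pendant (i', s', j)).
  rewrite big_distrr; apply: eq_bigr => j _; rewrite mulnC; congr (nat_of_bool _ * _).
  by rewrite !inE /= orbF.
rewrite !pendE !inE.
move: (mult F) {pendE} => n.
by elim/ord3P: i => /=; case: s; rewrite ?/(prev_triangle _) /= ?mul0n ?mul1n; lia.
Qed.

(** * Weight of one forest against the total weight *)

Definition conn_weight (c : conn) : nat :=
  match c with
  | inl (inl _) => 4
  | inr (inl _) => 1
  | _ => 2
  end.

(* A link needs both its ends unsaturated by the rest of the forest, but when no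
   heavier connection is given up, each triangle leaves only one bead so; as
   the links form an odd cycle, only one of the three is then used. *)
Lemma forest_weight (F : {set edge necklace}) :
  is_degree_forest (fun=> T.+2) F ->
  \sum_(e in F) conn_weight (tag e) <= 12 * T + 19.
Proof.
move=> [forF degF]; rewrite (sum_tag _ conn_weight) sum_conn sum_ord3 /=.
have triangle i :
    mult F (heavy i) + mult F (spoke (i, false)) + mult F (spoke (i, true)) <= 2.
  have := mult_forest (heavy i) forF; have := mult_forest (spoke (i, false)) forF.
  have := mult_forest (spoke (i, true)) forF.
  (* Each multiplicity is at most 1, so a sum above 2 would need all three sides of the triangle. *)
  suff: ~ [/\ 0 < mult F (heavy i), 0 < mult F (spoke (i, false))
             & 0 < mult F (spoke (i, true))].
    case: (mult F _) => [|[|//]]; case: (mult F _) => [|[|//]];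
    by case: (mult F _) => [|[|//]] //= H; case: H.
  case=> /card_gt0P[e1] + /card_gt0P[e2] + /card_gt0P[e3].
  rewrite !inE => /andP[F1 /eqP t1] /andP[F2 /eqP t2] /andP[F3 /eqP t3].
  apply: (@forest_triangle necklace F (core (i, true)) (core (i, false)) (hub i)
    e1 e2 e3) => //=.
  - by rewrite andbT !inE; apply/negP => /orP[] /eqP.
  - by rewrite t1 finset.setUC.
  - by rewrite t2.
  - by rewrite t3 finset.setUC.
have pendants p : \sum_j mult F (pendant (p, j)) <= T.
  rewrite -[leqRHS]card_ord -sum1_card; apply: leq_sum => j _.
  exact: mult_forest.
have heavies i : mult F (heavy i) <= 1 by exact: mult_forest.
have links i : mult F (link i) <= 1 by exact: mult_forest.
have deg i s := degF (core (i, s)).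
have {}deg i s : mult F (heavy i) + mult F (spoke (i, s))
    + mult F (link (if s then i else prev_triangle i))
    + \sum_j mult F (pendant (i, s, j)) <= T.+2.
  by rewrite -degree_core.
move: triangle pendants links heavies deg.
move: (mult F) => n triangle pendants links heavies deg; rewrite -!big_distrl /=.
move: (triangle i0) (triangle i1) (triangle i2).
move: (heavies i0) (heavies i1) (heavies i2).
move: (links i0) (links i1) (links i2).
move: (deg i0 true) (deg i0 false) (deg i1 true) (deg i1 false).
move: (deg i2 true) (deg i2 false).
move: (pendants (i0, true)) (pendants (i0, false)).
move: (pendants (i1, true)) (pendants (i1, false)).
move: (pendants (i2, true)) (pendants (i2, false)).
rewrite /prev_triangle /=.
move: (\sum_j n (pendant (i0, true, j))) (\sum_j n (pendant (i0, false, j))).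
move: (\sum_j n (pendant (i1, true, j))) (\sum_j n (pendant (i1, false, j))).
move: (\sum_j n (pendant (i2, true, j))) (\sum_j n (pendant (i2, false, j))).
move: (n (heavy i0)) (n (heavy i1)) (n (heavy i2)).
move: (n (spoke (i0, true))) (n (spoke (i0, false))).
move: (n (spoke (i1, true))) (n (spoke (i1, false))).
move: (n (spoke (i2, true))) (n (spoke (i2, false))).
move: (n (link i0)) (n (link i1)) (n (link i2)).
(* The six degree bounds plus 3 times all bounds of [triangle], [heavies] and [pendants] bound twice
   the weight by 24 T + 39. This is odd, so integrality gives 12 T + 19; this rounding is the whole
   gain over the average weight of 2m classes. *)
clear; intros; lia.
Qed.

Lemma total_weight :
  \sum_(e : edge necklace) conn_weight (tag e) = m * (24 * T + 39).
Proof.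
transitivity (\sum_(e in [set: edge necklace]) conn_weight (tag e)).
  by apply: eq_bigl => e; rewrite inE.
rewrite (sum_tag _ conn_weight) sum_conn sum_ord3.
rewrite mult_setT /= -!big_distrl /= !sum_nat_const card_ord; lia.
Qed.

(** * Degrees in the necklace *)

Lemma degree_core_setT p : degree [set: edge necklace] (core p) = T.+2 * m.*2.
Proof.
case: p => i s; rewrite degree_core mult_setT /= sum_nat_const card_ord; lia.
Qed.

Lemma degree_setT v : degree [set: edge necklace] v <= T.+2 * m.*2.
Proof.
have le : m.*2 <= T.+2 * m.*2 by lia.
case: v => [[p|i]|q]; first by rewrite degree_core_setT.
(* A hub meets just its two spokes, of multiplicity m each; a leaf, below, meets a single bundle of
   2m edges. *)
- rewrite degree_fattening mult_setT (bigD1 (spoke (i, false))) //=.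
  rewrite (bigD1 (spoke (i, true))) /=; last by apply/eqP.
  rewrite big1 ?addn0.
    by rewrite (leq_trans _ le) // -addnn leq_add // -[leqRHS]muln1 leq_mul ?leq_b1.
  case=> [[j|[j s]]|[j|q]] /andP[ne1 ne2]; rewrite !inE //= ?muln0 //.
  case: eqP => [[eij]|]; rewrite ?muln0 //=.
  by subst j; case: s ne1 ne2; rewrite eqxx.
- rewrite degree_fattening mult_setT (bigD1 (pendant q)) //= big1 ?addn0.
    by rewrite (leq_trans _ le) // -[leqRHS]muln1 leq_mul ?leq_b1.
  case=> [[j|[j s]]|[j|q']] ne; rewrite !inE //= ?muln0 //.
  case: eqP => [[eqq]|]; rewrite ?muln0 //=.
  by subst q'; rewrite eqxx in ne.
Qed.

(** * Decomposition into 2m forests *)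

(** Edge number j of a bundle gets colour offset + j. Bundles of size 2m thus use every colour once;
    the two spokes at a hub use complementary halves, and the link closing the odd cycle is
    separated from the other two. *)
Definition conn_offset (c : conn) : nat :=
  match c with
  | inl (inr p) => if p.2 then 0 else m
  | inr (inl i) => if i == i2 then m else 0
  | _ => 0
  end.

Lemma conn_offset_lt (e : edge necklace) :
  conn_offset (tag e) + tagged e < m.*2.
Proof.
case: e => c /= [j /=].
by case: c => [[i|[i []]]|[i|q]] /=; try case: ifP; lia.
Qed.

Lemma necklace_forests : edge_colorable (@is_forest necklace) m.*2.
Proof.
exists (fun e => Ordinal (conn_offset_lt e)) => q.
(* In colours below m the beads form the path u_0 v_0 u_1 v_1 u_2 v_2. In the others the only link
   is v_2 u_0, so triangle [i2] moves to the front, to ranks 0 and 1 left free by the shift [.+2].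
   The value 9 exceeds all bead ranks. *)
pose rank (v : node) := match v with
  | inl (inl (i, s)) =>
      if (m <= q) && (i == i2) then nat_of_bool s else (i.*2 + s).+2
  | _ => 9
  end.
have colE e : (e \in [set e | Ordinal (conn_offset_lt e) == q]) ->
    conn_offset (tag e) + tagged e = q by rewrite inE => /eqP/(congr1 val).
apply: (@ranked_forest necklace [set e | Ordinal (conn_offset_lt e) == q] rank
          (fun e => (conn_ends (tag e)).1)
          (fun e => (conn_ends (tag e)).2)).
- by [].
- move=> e /colE; case: e => c /= [j /=].
  case: c => [[i|[i s]]|[i|[[i s] l]]] /=.
  + by move=> _ _; case: ifP => //; lia.
  + by move=> _ _; elim/ord3P: i => /=; case: s; rewrite ?andbF ?andbT //=; case: ifP.
  + by elim/ord3P: i => /=; rewrite ?andbF ?andbT //= => jm qE; case: ifP; lia.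
  + by move=> _ _; elim/ord3P: i => /=; case: s; rewrite ?andbF ?andbT //=; case: ifP.
- move=> e e' /colE + /colE; case: e => c j; case: e' => c' j' /= qE qE' topE.
  suff cc' : c = c'.
    subst c'; congr Tagged; apply/val_inj.
    by apply: (@addnI (conn_offset c)); rewrite qE qE'.
  have next_triangle_inj : injective next_triangle by elim/ord3P; elim/ord3P.
  case: c j qE topE => [[i|[i s]]|[i|p]] /= j qE;
  case: c' j' qE' => [[i'|[i' s']]|[i'|p']] //= j' qE' [].
  all: try by [move=> -> | move=> /next_triangle_inj ->]. move=> <-.
  (* Two spokes with the same hub and the same colour: their offsets 0 and m rule out different
     beads. *)
  by case: s qE; case: s' qE'; move: (ltn_ord j) (ltn_ord j') => //=; lia.
Qed.


End Necklace.

(** * Parameters of the necklace and the conclusion *)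

Lemma ceil_div_leq a b n : 0 < n -> a <= n * b -> ceil_div a n <= b.
Proof.
move=> n0 le; rewrite /ceil_div; case: (boolP (n %| a)) => [|ndvd].
  by rewrite addn0 -(leq_pmul2l n0) mulnC => /divnK ->.
rewrite addn1 ltn_divLR // mulnC ltn_neqAle le andbT.
by apply: contraNneq ndvd => ->; rewrite dvdn_mulr.
Qed.

Lemma necklace_ratio T m : const_max_degree_ratio (necklace T m) T.+2 = m.*2.
Proof.
apply/eqP; rewrite eqn_leq; apply/andP; split.
  by apply/bigmax_leqP => v _; apply: ceil_div_leq => //; exact: degree_setT.
apply: leq_trans (leq_bigmax (core T (i0, true) : vertex (necklace T m))).
by rewrite degree_core_setT /ceil_div mulKn // leq_addr.
Qed.

Lemma necklace_arboricity T m : arboricity (necklace T m) <= m.*2.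
Proof.
rewrite /arboricity; case: ex_minnP => k _ /(_ m.*2); apply; apply/asboolP.
exact: necklace_forests.
Qed.

Lemma necklace_degree_arboricity T m (t2 : 2 <= T.+2) :
  m * (24 * T + 39) <= const_degree_arboricity (necklace T m) t2 * (12 * T + 19).
Proof.
rewrite /const_degree_arboricity /degree_arboricity; case: ex_minnP => k + _.
move=> /asboolP/colorable_weight wk; rewrite -total_weight; apply: wk.
exact: forest_weight.
Qed.

Theorem theorem3 (R : realType) (t : nat) (t2 : 2 <= t) :
  exists c : R, (1 < c)%R /\
    infinite_set [set d : nat | 2 <= d /\
      exists G : multigraph,
        maxn (const_max_degree_ratio G t) (arboricity G) = d /\
        (c * d%:R <= (const_degree_arboricity G t2)%:R)%R]%classic.
Proof.
case: t t2 => [|[|T]] // t2.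
(* With d = 2m, this is the total weight m (24 T + 39) divided by d times the forest bound 12 T +
   19. *)
exists ((24 * T + 39)%:R / (24 * T + 38)%:R)%R; split.
  by rewrite ltr_pdivlMr ?mul1r ?ltr_nat ?ltr0n //; lia.
set A := (X in infinite_set X).
have inA m : A m.+1.*2.
  split; first by lia.
  exists (necklace T m.+1); split.
    by rewrite necklace_ratio; apply/maxn_idPl/necklace_arboricity.
  rewrite mulrAC ler_pdivrMr ?ltr0n; last by lia.
  rewrite -!natrM ler_nat.
  have := necklace_degree_arboricity m.+1 t2; lia.
(* This map sends 2 (n + 1) to n, so the image of [A] contains every natural number. *)
move=> /(finite_image (fun n => n./2.-1)); apply: contra_not infinite_nat.
by apply: sub_finite_set => n _; exists n.+1.*2 => //=; rewrite doubleK.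
Qed.
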